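(* Let $(\mathfrak{g},\gamma)$ be a finite dimensional Lie bialgebra over $k$ with Drinfeld double $D(\mathfrak{g})$. Let $(\mathfrak{q},\beta)$ be a quasi-Frobenius Lie algebra over $k$ and let $\rho: D(\mathfrak{g})\rightarrow \mathfrak{gl}(\mathfrak{q})$ be a linear map (not necessarily a representation). Define $\varphi:=\rho|_{\mathfrak{g}}$ and $\psi:=\rho|_{\mathfrak{g}^\ast}$. Then $(\mathfrak{q},\beta,\rho)$ is a $D(\mathfrak{g})$-quasi-Frobenius Lie algebra if and only if the following conditions are satisfied: (a) $\psi_{ad^\ast_x\xi}-\varphi_{ad^\ast_\xi x}=\varphi_x\circ \psi_\xi-\psi_\xi\circ \varphi_x$ for all $x\in \mathfrak{g}$, $\xi\in \mathfrak{g}^\ast$; (b) $(\mathfrak{q},\beta,\varphi)$ is a $\mathfrak{g}$-quasi-Frobenius Lie algebra; (c) $(\mathfrak{q},\beta,\psi)$ is a $\mathfrak{g}^\ast$-quasi-Frobenius Lie algebra.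
   Context: $k$ is a field of characteristic zero. A quasi-Frobenius Lie algebra over $k$ is a pair $(\mathfrak{q},\beta)$ where $\mathfrak{q}$ is a Lie algebra over $k$ and $\beta$ is a nondegenerate skew-symmetric bilinear form on $\mathfrak{q}$ with $\beta([u,v],w)+\beta([v,w],u)+\beta([w,u],v)=0$ for all $u,v,w\in\mathfrak{q}$. For a finite dimensional Lie algebra $\mathfrak{h}$ over $k$, an $\mathfrak{h}$-quasi-Frobenius Lie algebra is a triple $(\mathfrak{q},\beta,\rho)$ where $(\mathfrak{q},\beta)$ is quasi-Frobenius and $\rho:\mathfrak{h}\to\mathfrak{gl}(\mathfrak{q})$, $x\mapsto\rho_x$, is a representation such that each $\rho_x$ is a derivation of $\mathfrak{q}$ and $\beta(\rho_x(u),v)+\beta(u,\rho_x(v))=0$ for all $x\in\mathfrak{h}$, $u,v\in\mathfrak{q}$. A Lie bialgebra is a pair $(\mathfrak{g},\gamma)$ where $\mathfrak{g}$ is a Lie algebra and $\gamma:\mathfrak{g}\to\mathfrak{g}\wedge\mathfrak{g}\subset\mathfrak{g}\otimes\mathfrak{g}$ is linear such that $\gamma^\ast$ restricted to $\mathfrak{g}^\ast\otimes\mathfrak{g}^\ast$ is a Lie bracket on $\mathfrak{g}^\ast$, and $\gamma([x,y])=ad^{(2)}_x\gamma(y)-ad^{(2)}_y\gamma(x)$, where $ad^{(2)}_x(y\otimes z)=[x,y]\otimes z+y\otimes[x,z]$. $\mathfrak{g}^\ast$ always carries this bracket: $[\xi,\eta](x)=(\xi\otimes\eta)(\gamma(x))$.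 The Drinfeld double $D(\mathfrak{g})$ is, as a Lie algebra, the vector space $\mathfrak{g}\oplus\mathfrak{g}^\ast$ containing $\mathfrak{g}$ and $\mathfrak{g}^\ast$ as Lie subalgebras, with mixed bracket $[x,\xi]=ad^\ast_x\xi-ad^\ast_\xi x$ for $x\in\mathfrak{g}$, $\xi\in\mathfrak{g}^\ast$, where $ad^\ast_x:=-(ad_x)^t:\mathfrak{g}^\ast\to\mathfrak{g}^\ast$ and $ad^\ast_\xi:=-(ad_\xi)^t:\mathfrak{g}\to\mathfrak{g}$ (using $\mathfrak{g}^{\ast\ast}=\mathfrak{g}$). *)

(* Defs.v *)
From HB Require Import structures.
From mathcomp Require Import all_boot all_order all_algebra.
From mathcomp Require Import ring.

Set Implicit Arguments.
Unset Strict Implicit.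
Unset Printing Implicit Defensive.
Import GRing.Theory.
Local Open Scope ring_scope.

Reserved Notation "u *t v" (at level 40, left associativity).

Section Bilinear.
Variables (k : fieldType) (U V W : lmodType k).

Definition is_bilinear (f : U -> V -> W) : Prop :=
  (forall v, linear (f^~ v)) /\ (forall u, linear (f u)).

Variables (f : U -> V -> W) (bf : is_bilinear f).

Let fr u : {linear V -> W} :=
  HB.pack (f u) (GRing.isLinear.Build k V W *:%R (f u) (bf.2 u)).
Let fl v : {linear U -> W} :=
  HB.pack (f^~ v) (GRing.isLinear.Build k U W *:%R (f^~ v) (bf.1 v)).

Lemma bilDr u : {morph f u : x y / x + y}. Proof. exact: (linearD (fr u)). Qed.
Lemma bilBr u : {morph f u : x y / x - y}. Proof. exact: (linearB (fr u)). Qed.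
Lemma bilNr u : {morph f u : x / - x}. Proof. exact: (linearN (fr u)). Qed.
Lemma bilDl v : {morph f^~ v : x y / x + y}.
Proof. exact: (linearD (fl v)). Qed.
Lemma bilNl v : {morph f^~ v : x / - x}. Proof. exact: (linearN (fl v)). Qed.
Lemma bil_sumZl I (r : seq I) (a : I -> k) (x : I -> U) v :
  f (\sum_(i <- r) a i *: x i) v = \sum_(i <- r) a i *: f (x i) v.
Proof.
rewrite -[LHS]/(fl v _) linear_sum; apply: eq_bigr => i _.
by rewrite linearZ.
Qed.
Lemma bilZr u a v : f u (a *: v) = a *: f u v.
Proof. exact: (linearZ_LR (fr u)). Qed.

End Bilinear.

Section LieBracket.
Variables (k : fieldType) (V : lmodType k).

Definition is_lie_bracket (br : V -> V -> V) : Prop :=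
  [/\ is_bilinear br,
      (forall x, br x x = 0) &
      (forall x y z, br x (br y z) + br y (br z x) + br z (br x y) = 0)].

End LieBracket.

HB.mixin Record Lmodule_isLieAlgebra (k : fieldType) V of GRing.Lmodule k V := {
  lie : V -> V -> V;
  lieP : is_lie_bracket lie
}.

#[short(type="lieAlgType")]
HB.structure Definition LieAlgebra (k : fieldType) :=
  { V of GRing.Lmodule k V & Lmodule_isLieAlgebra k V }.

#[short(type="finLieAlgType")]
HB.structure Definition FinLieAlgebra (k : fieldType) :=
  { V of Vector k V & Lmodule_isLieAlgebra k V }.

Section LieTheory.
Variables (k : fieldType) (g : lieAlgType k).
Implicit Types x y z : g.

Lemma lie_bilinear : is_bilinear (@lie k g).
Proof. by case: (@lieP k g). Qed.
Lemma liexx x : lie x x = 0. Proof. by case: (@lieP k g). Qed.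
Lemma lie_jacobi x y z :
  lie x (lie y z) + lie y (lie z x) + lie z (lie x y) = 0.
Proof. by case: (@lieP k g). Qed.
Lemma lieDl x y z : lie (x + y) z = lie x z + lie y z.
Proof. exact: (bilDl lie_bilinear). Qed.
Lemma lieDr x y z : lie x (y + z) = lie x y + lie x z.
Proof. exact: (bilDr lie_bilinear). Qed.
Lemma lieNl x y : lie (- x) y = - lie x y.
Proof. exact: (bilNl lie_bilinear). Qed.
Lemma lieBr x y z : lie x (y - z) = lie x y - lie x z.
Proof. exact: (bilBr lie_bilinear). Qed.
Lemma lieNr x y : lie x (- y) = - lie x y.
Proof. exact: (bilNr lie_bilinear). Qed.
Lemma lie0l x : lie 0 x = 0.
Proof. by rewrite -{1}(subrr x) lieDl lieNl subrr. Qed.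
Lemma lie0r x : lie x 0 = 0.
Proof. by rewrite -{1}(subrr x) lieBr subrr. Qed.
Lemma lieZDl a x y z : lie (a *: x + y) z = a *: lie x z + lie y z.
Proof. exact: lie_bilinear.1. Qed.
Lemma lieZDr a x y z : lie x (a *: y + z) = a *: lie x y + lie x z.
Proof. exact: lie_bilinear.2. Qed.
Lemma lieC x y : lie x y = - lie y x.
Proof.
have := liexx (x + y); rewrite lieDl !lieDr !liexx add0r addr0 => /eqP.
by rewrite addr_eq0 => /eqP.
Qed.
Lemma lie_jacobiA x y z : lie (lie x y) z = lie x (lie y z) - lie y (lie x z).
Proof.
rewrite lieC (lieC x z) lieNr opprK; apply/eqP.
by rewrite eq_sym -subr_eq0 opprK lie_jacobi.
Qed.

End LieTheory.

(* The linear dual.  A named alias of 'Hom(V, k^o), so that the Lie bracket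
   defined below on the dual of a Lie bialgebra can be attached to it. *)
Definition ldual (k : fieldType) (V : vectType k) : Type := 'Hom(V, k^o).
#[warnings="-redundant-canonical-projection"]
HB.instance Definition _ (k : fieldType) (V : vectType k) :=
  Vector.copy (ldual V) 'Hom(V, k^o).
Definition ev (k : fieldType) (V : vectType k) (xi : ldual V) : V -> k :=
  fun v => (xi : 'Hom(V, k^o)) v.
Arguments ev : simpl never.

Section Dual.
Variables (k : fieldType) (V : vectType k).
Implicit Types (xi eta : ldual V) (v w : V).

Lemma dualDl xi eta v : ev (xi + eta) v = ev xi v + ev eta v.
Proof. by rewrite /ev add_lfunE. Qed.
Lemma dualNl xi v : ev (- xi) v = - ev xi v.
Proof. by rewrite /ev opp_lfunE. Qed.
Lemma dualZl a xi v : ev (a *: xi) v = a * ev xi v.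
Proof. by rewrite /ev scale_lfunE. Qed.
Lemma dual0l v : ev (0 : ldual V) v = 0.
Proof. by rewrite /ev zero_lfunE. Qed.
Lemma dualD xi v w : ev xi (v + w) = ev xi v + ev xi w.
Proof. by rewrite /ev linearD. Qed.
Lemma dualN xi v : ev xi (- v) = - ev xi v.
Proof. by rewrite /ev linearN. Qed.
Lemma dualB xi v w : ev xi (v - w) = ev xi v - ev xi w.
Proof. by rewrite dualD dualN. Qed.
Lemma dualZ xi a v : ev xi (a *: v) = a * ev xi v.
Proof. by rewrite /ev linearZ. Qed.
Lemma dual0 xi : ev xi 0 = 0.
Proof. by rewrite /ev linear0. Qed.
Lemma dual_sum I (r : seq I) xi (F : I -> V) :
  ev xi (\sum_(i <- r) F i) = \sum_(i <- r) ev xi (F i).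
Proof. by rewrite /ev linear_sum. Qed.
Lemma dual_suml I (r : seq I) (F : I -> ldual V) v :
  ev (\sum_(i <- r) F i) v = \sum_(i <- r) ev (F i) v.
Proof. by rewrite /ev sum_lfunE. Qed.
Lemma dualP xi eta : (forall v, ev xi v = ev eta v) -> xi = eta.
Proof. by move=> h; apply/lfunP => v; apply: h. Qed.

Definition dual_basis (i : 'I_(\dim {:V})) : ldual V :=
  linfun (coord (vbasis {:V}) i : V -> k^o).

Lemma dual_basisE i v : ev (dual_basis i) v = coord (vbasis {:V}) i v.
Proof. by rewrite /ev /dual_basis lfunE. Qed.

Lemma dual_basis_sum v : v = \sum_i ev (dual_basis i) v *: (vbasis {:V})`_i.
Proof.
rewrite [LHS](coord_vbasis (memvf v)); apply: eq_bigr => i _.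
by rewrite dual_basisE.
Qed.

Lemma dual_sep v w : (forall xi, ev xi v = ev xi w) -> v = w.
Proof.
move=> h; rewrite (dual_basis_sum v) (dual_basis_sum w).
by apply: eq_bigr => i _; rewrite h.
Qed.

End Dual.

Section Bidual.
Variables (k : fieldType) (V : vectType k).

(* The canonical map V -> V^**, an isomorphism since V is finite dimensional. *)
Definition bidual_ev : 'Hom(V, ldual (ldual V)) :=
  linfun (fun v =>
    linfun (fun xi : ldual V => ev xi v : k^o) : ldual (ldual V)).

Let bidual_lin v : linear (fun xi : ldual V => ev xi v : k^o).
Proof. by move=> a xi eta; rewrite /= dualDl dualZl. Qed.

Lemma bidual_evE v xi : ev (bidual_ev v) xi = ev xi v.
Proof.
pose fv u : {linear ldual V -> k^o} := HB.pack
  (fun xi : ldual V => ev xi u : k^o)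
  (GRing.isLinear.Build _ _ _ _ _ (bidual_lin u)).
pose F u : ldual (ldual V) := linfun (fv u).
have FE u eta : ev (F u) eta = ev eta u.
  by rewrite -[LHS]/((linfun (fv u) : 'Hom(_, _)) eta) lfunE.
have Flin : linear F.
  move=> a u w; apply: dualP => eta.
  by rewrite dualDl dualZl !FE dualD dualZ.
pose FL : {linear V -> ldual (ldual V)} :=
  HB.pack F (GRing.isLinear.Build _ _ _ _ _ Flin).
by rewrite -[bidual_ev v]/(linfun FL v) lfunE /= FE.
Qed.

Lemma bidual_ev_inj : lker bidual_ev = 0%VS.
Proof.
apply/eqP/lker0P => v w evw; apply: dual_sep => xi.
by rewrite -!bidual_evE evw.
Qed.

Lemma bidual_ev_surj (T : ldual (ldual V)) : bidual_ev (bidual_ev^-1%VF T) = T.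
Proof.
apply: limg_lfunVK.
suff -> : limg bidual_ev = fullv by apply: memvf.
apply/eqP; rewrite eqEdim subvf /=.
have := limg_ker_dim bidual_ev fullv.
rewrite bidual_ev_inj capv0 dimv0 add0n => ->.
by rewrite !dimvf; change (dim V * 1 * 1 <= dim V)%N; rewrite !muln1.
Qed.

Lemma bidual_evVE (T : ldual (ldual V)) xi :
  ev xi (bidual_ev^-1%VF T) = ev T xi.
Proof. by rewrite -[in RHS](bidual_ev_surj T) bidual_evE. Qed.

End Bidual.

(* The tensor product of two finite dimensional spaces, realized as
   Hom(U^*, V) with u *t v := (xi |-> xi(u) v).  The lemmas tliftE and
   tensor_ext below are its universal property. *)
Definition tensor (k : fieldType) (U V : vectType k) : Type := 'Hom(ldual U, V).
#[warnings="-redundant-canonical-projection"]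
HB.instance Definition _ (k : fieldType) (U V : vectType k) :=
  Vector.copy (tensor U V) 'Hom(ldual U, V).

Definition tapp (k : fieldType) (U V : vectType k) (t : tensor U V)
  (xi : ldual U) : V := (t : 'Hom(ldual U, V)) xi.
Arguments tapp : simpl never.

Definition tens (k : fieldType) (U V : vectType k) (u : U) (v : V) :
  tensor U V := linfun (fun xi : ldual U => ev xi u *: v).
Notation "u *t v" := (tens u v) : ring_scope.

(* The linear map on the tensor product sending u *t v to f u v (only
   meaningful when f is bilinear). *)
Definition tlift (k : fieldType) (U V W : vectType k) (f : U -> V -> W) :
  'Hom(tensor U V, W) :=
  linfun (fun t : tensor U V =>
    \sum_(i < \dim {:U}) f (vbasis {:U})`_i (tapp t (dual_basis i))).

Section Tensor.
Variables (k : fieldType) (U V W : vectType k).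

Lemma tappDl (s t : tensor U V) xi : tapp (s + t) xi = tapp s xi + tapp t xi.
Proof. by rewrite /tapp add_lfunE. Qed.
Lemma tappZl a (t : tensor U V) xi : tapp (a *: t) xi = a *: tapp t xi.
Proof. by rewrite /tapp scale_lfunE. Qed.
Lemma tapp_suml I (r : seq I) (F : I -> tensor U V) xi :
  tapp (\sum_(i <- r) F i) xi = \sum_(i <- r) tapp (F i) xi.
Proof. by rewrite /tapp sum_lfunE. Qed.
Lemma tapp_sum I (r : seq I) (t : tensor U V) (F : I -> ldual U) :
  tapp t (\sum_(i <- r) F i) = \sum_(i <- r) tapp t (F i).
Proof. by rewrite /tapp linear_sum. Qed.
Lemma tappZ a (t : tensor U V) xi : tapp t (a *: xi) = a *: tapp t xi.
Proof. by rewrite /tapp linearZ. Qed.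
Lemma tappP (s t : tensor U V) : (forall xi, tapp s xi = tapp t xi) -> s = t.
Proof. by move=> h; apply/lfunP => xi; apply: h. Qed.

Lemma tensE (u : U) (v : V) xi : tapp (u *t v) xi = ev xi u *: v.
Proof.
have L : linear (fun xi : ldual U => ev xi u *: v).
  by move=> a x y; rewrite dualDl dualZl scalerDl scalerA.
pose F : {linear ldual U -> V} := HB.pack (fun xi : ldual U => ev xi u *: v)
  (GRing.isLinear.Build _ _ _ _ _ L).
by rewrite -[LHS]/((linfun F : 'Hom(_, _)) xi) lfunE.
Qed.

Lemma tens_bilinear : is_bilinear (@tens k U V).
Proof.
split=> [v|u] a x y; apply: tappP => xi; rewrite tappDl tappZl !tensE.
  by rewrite dualD dualZ scalerDl scalerA.
by rewrite scalerDr !scalerA mulrC.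
Qed.

Lemma tensor_sum (t : tensor U V) :
  t = \sum_(i < \dim {:U}) (vbasis {:U})`_i *t tapp t (dual_basis i).
Proof.
apply: tappP => xi; rewrite tapp_suml.
have {1}-> : xi = \sum_(i < \dim {:U}) ev xi (vbasis {:U})`_i *: dual_basis i.
  apply: dualP => v.
  rewrite {1}(dual_basis_sum v) dual_sum dual_suml.
  by apply: eq_bigr => i _; rewrite dualZ dualZl mulrC.
by rewrite tapp_sum; apply: eq_bigr => i _; rewrite tappZ tensE.
Qed.

Lemma tensor_ext (F G : 'Hom(tensor U V, W)) :
  (forall u v, F (u *t v) = G (u *t v)) -> F = G.
Proof.
move=> h; apply/lfunP => t; rewrite (tensor_sum t) !linear_sum.
by apply: eq_bigr => i _; apply: h.
Qed.

Lemma tliftE (f : U -> V -> W) (u : U) (v : V) :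
  is_bilinear f -> tlift f (u *t v) = f u v.
Proof.
move=> bf; pose F (t : tensor U V) :=
  \sum_(i < \dim {:U}) f (vbasis {:U})`_i (tapp t (dual_basis i)).
have L : linear F.
  move=> a s t; rewrite /F scaler_sumr -big_split /=; apply: eq_bigr => i _.
  by rewrite tappDl tappZl bf.2.
pose FL : {linear tensor U V -> W} :=
  HB.pack F (GRing.isLinear.Build _ _ _ _ _ L).
rewrite -[LHS]/((linfun FL : 'Hom(_, _)) (u *t v)) lfunE /= /F.
rewrite [in RHS](dual_basis_sum u) bil_sumZl //; apply: eq_bigr => i _.
by rewrite tensE bilZr.
Qed.

End Tensor.

Section Cobracket.
Variables (k : fieldType) (g : vectType k).

Definition tpair (xi eta : ldual g) : ldual (tensor g g) :=
  tlift (fun y z : g => ev xi y * ev eta z : k^o).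

Definition tflip : 'End(tensor g g) := tlift (fun y z : g => z *t y).

(* The span of the y *t z - z *t y. *)
Definition wedge2 : {vspace tensor g g} := limg (\1 - tflip)%VF.

Definition cobr_dual (gamma : 'Hom(g, tensor g g)) (xi eta : ldual g) :
  ldual g :=
  ((tpair xi eta : 'Hom(tensor g g, k^o)) \o gamma)%VF.

Lemma tpairE xi eta (y z : g) : ev (tpair xi eta) (y *t z) = ev xi y * ev eta z.
Proof.
apply: (@tliftE k g g k^o (fun y z : g => ev xi y * ev eta z)).
split=> [v|u] a x w /=.
  by rewrite dualD dualZ mulrDl -mulrA.
by rewrite dualD dualZ mulrDr mulrCA.
Qed.

Lemma tflipE (y z : g) : tflip (y *t z) = z *t y.
Proof. by apply: tliftE; split=> v; apply tens_bilinear. Qed.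

Lemma cobr_dualE gamma xi eta x :
  ev (cobr_dual gamma xi eta) x = ev (tpair xi eta) (gamma x).
Proof. by rewrite /ev /cobr_dual comp_lfunE. Qed.

End Cobracket.

Definition ad2 (k : fieldType) (g : finLieAlgType k) (x : g) :
  'End(tensor g g) := tlift (fun y z : g => lie x y *t z + y *t lie x z).

Lemma ad2E (k : fieldType) (g : finLieAlgType k) (x y z : g) :
  ad2 x (y *t z) = lie x y *t z + y *t lie x z.
Proof.
have tb := @tens_bilinear k g g; have lb := @lie_bilinear k g.
apply: tliftE; split=> w a u v /=.
  by rewrite lb.2 !tb.1 scalerDr addrACA.
by rewrite lb.2 !tb.2 scalerDr addrACA.
Qed.

HB.mixin Record FinLieAlgebra_isLieBialgebra (k : fieldType) (g : Type)
    of FinLieAlgebra k g := {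
  cobr : 'Hom(g, tensor g g);
  cobr_wedge : forall x : g, cobr x \in wedge2 g;
  cobr_dual_lie : is_lie_bracket (cobr_dual cobr);
  cobr_cocycle : forall x y : g,
    cobr (lie x y) = ad2 x (cobr y) - ad2 y (cobr x)
}.

#[short(type="lieBialgType")]
HB.structure Definition LieBialgebra (k : fieldType) :=
  { g of FinLieAlgebra k g & FinLieAlgebra_isLieBialgebra k g }.

HB.instance Definition _ (k : fieldType) (g : lieBialgType k) :=
  Lmodule_isLieAlgebra.Build k (ldual g) (@cobr_dual_lie k g).

(* The coadjoint action ad^*_x = - (ad_x)^t of a Lie algebra on its dual. *)
Definition coad (k : fieldType) (h : finLieAlgType k) (x : h) (xi : ldual h) :
  ldual h := - linfun (fun y : h => ev xi (lie x y) : k^o).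

(* For a Lie bialgebra g, the coadjoint action ad^*_xi of g^* on g = g^**. *)
Definition coad_dual (k : fieldType) (g : lieBialgType k)
  (xi : ldual g) (x : g) : g :=
  ((@bidual_ev k g)^-1)%VF (coad xi (bidual_ev g x)).

Section Coadjoint.

Lemma coadE (k : fieldType) (h : finLieAlgType k) (x y : h) xi :
  ev (coad x xi) y = - ev xi (lie x y).
Proof.
have L : linear (fun y : h => ev xi (lie x y) : k^o).
  by move=> a u v; rewrite (@lie_bilinear k h).2 dualD dualZ.
pose F : {linear h -> k^o} := HB.pack (fun y : h => ev xi (lie x y) : k^o)
  (GRing.isLinear.Build _ _ _ _ _ L).
by rewrite /coad dualNl; congr (- _); rewrite -[LHS]/(linfun F y) lfunE.
Qed.

Variables (k : fieldType) (g : lieBialgType k).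

Lemma coad_dualE (xi eta : ldual g) (x : g) :
  ev eta (coad_dual xi x) = - ev (lie xi eta) x.
Proof. by rewrite bidual_evVE coadE bidual_evE. Qed.

Lemma lie_dual_cocycle (xi eta : ldual g) (x y : g) :
  ev (lie xi eta) (lie x y) =
  - ev (lie (coad x xi) eta) y - ev (lie xi (coad x eta)) y
  + ev (lie (coad y xi) eta) x + ev (lie xi (coad y eta)) x.
Proof.
have A (u v : g) : ev (tpair xi eta) (ad2 u (cobr v)) =
    - ev (lie (coad u xi) eta) v - ev (lie xi (coad u eta)) v.
  rewrite !cobr_dualE; move: (cobr v) => t.
  rewrite (tensor_sum t) /ev !linear_sum /= -!sumrN -big_split /=.
  apply: eq_bigr => i _; rewrite ad2E.
  rewrite -!/(ev _ _) dualD !tpairE !coadE; ring.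
by rewrite cobr_dualE cobr_cocycle dualB !A; ring.
Qed.

End Coadjoint.

(* The Drinfeld double: g (+) g^*, with the elements (x, xi). *)
Definition drinfeld_double (k : fieldType) (g : lieBialgType k) : Type :=
  (g * ldual g)%type.
#[warnings="-redundant-canonical-projection"]
HB.instance Definition _ (k : fieldType) (g : lieBialgType k) :=
  Vector.copy (drinfeld_double g) (g * ldual g)%type.


Section Double.
Variables (k : fieldType) (g : lieBialgType k).

Definition in_g (x : g) : drinfeld_double g := (x, 0).
Definition in_dual (xi : ldual g) : drinfeld_double g := (0, xi).

(* [x, xi] for x in g and xi in g^*. *)
Definition double_mixed (x : g) (xi : ldual g) : drinfeld_double g :=
  in_dual (coad x xi) - in_g (coad_dual xi x).

Definition double_lie (a b : drinfeld_double g) : drinfeld_double g :=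
  in_g (lie a.1 b.1) + double_mixed a.1 b.2 - double_mixed b.1 a.2
  + in_dual (lie a.2 b.2).

Lemma double_lie1 (a b : drinfeld_double g) om :
  ev om (double_lie a b).1
  = ev om (lie a.1 b.1) + ev (lie b.2 om) a.1 - ev (lie a.2 om) b.1.
Proof.
rewrite /double_lie /double_mixed /in_g /in_dual /=.
by rewrite !(dualD, dualN, dual0) !coad_dualE; ring.
Qed.

Lemma double_lie2 (a b : drinfeld_double g) z :
  ev (double_lie a b).2 z
  = ev (lie a.2 b.2) z - ev b.2 (lie a.1 z) + ev a.2 (lie b.1 z).
Proof.
rewrite /double_lie /double_mixed /in_g /in_dual /=.
by rewrite !(dualDl, coadE, dualNl, dual0l); ring.
Qed.

Lemma double_ext (a b : drinfeld_double g) :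
  (forall om, ev om a.1 = ev om b.1) -> (forall z, ev a.2 z = ev b.2 z) ->
  a = b.
Proof.
case: a b => [a1 a2] [b1 b2] /= h1 h2.
by rewrite (dual_sep h1) (dualP h2).
Qed.

Let coad_lie (x y : g) (xi : ldual g) : ev xi (lie x y) = - ev (coad x xi) y.
Proof. by rewrite coadE opprK. Qed.

Let lie_coad (xi eta : ldual g) (x : g) :
  ev (lie xi eta) x = - ev eta (coad_dual xi x).
Proof. by rewrite coad_dualE opprK. Qed.

Let double_lie_lie1 (a b c : drinfeld_double g) om :
  ev om (double_lie a (double_lie b c)).1 =
  ev om (lie a.1 (lie b.1 c.1))
  - ev (lie c.2 (coad a.1 om)) b.1 + ev (lie b.2 (coad a.1 om)) c.1
  + ev (lie (lie b.2 c.2) om) a.1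
  + ev (lie (coad b.1 c.2) om) a.1 - ev (lie (coad c.1 b.2) om) a.1
  + ev (lie (coad b.1 a.2) om) c.1 + ev (lie a.2 (coad b.1 om)) c.1
  - ev (lie (coad c.1 a.2) om) b.1 - ev (lie a.2 (coad c.1 om)) b.1
  - ev (lie c.2 (lie a.2 om)) b.1 + ev (lie b.2 (lie a.2 om)) c.1.
Proof.
rewrite double_lie1; set D := double_lie b c.
rewrite (coad_lie a.1 D.1) (lieC D.2) (dualNl (lie _ _)) (lie_coad om).
rewrite !double_lie1.
rewrite double_lie2 lie_dual_cocycle (coad_lie b.1 (coad_dual _ _)).
rewrite (coad_lie c.1 (coad_dual _ _)) !coad_dualE !coadE.
rewrite !(lieC om) !dualNl; ring.
Qed.

Let double_lie_lie2 (a b c : drinfeld_double g) z :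
  ev (double_lie a (double_lie b c)).2 z =
  ev (lie a.2 (lie b.2 c.2)) z
  + ev (lie a.2 (coad b.1 c.2)) z - ev (lie a.2 (coad c.1 b.2)) z
  - ev (lie c.2 (coad a.1 b.2)) z + ev (lie b.2 (coad a.1 c.2)) z
  + ev (lie c.2 (coad z b.2)) a.1 - ev (lie b.2 (coad z c.2)) a.1
  + ev c.2 (lie b.1 (lie a.1 z)) - ev b.2 (lie c.1 (lie a.1 z))
  + ev a.2 (lie b.1 (lie c.1 z)) - ev a.2 (lie c.1 (lie b.1 z))
  + ev (lie c.2 (coad z a.2)) b.1 - ev (lie b.2 (coad z a.2)) c.1.
Proof.
rewrite double_lie2; set D := double_lie b c.
rewrite (lieC D.1) dualN (coad_lie z D.1) (lie_coad a.2 D.2) !double_lie1.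
rewrite !double_lie2 lie_dual_cocycle (coad_lie b.1 (coad_dual _ _)).
rewrite (coad_lie c.1 (coad_dual _ _)) !coad_dualE (coadE z (lie b.1 c.1)).
rewrite (lieC z) lie_jacobiA (lieC (coad _ _)) (lieC (coad z _)).
by rewrite !dualNl !(dualD, dualN); ring.
Qed.

Lemma double_lie_is_lie : is_lie_bracket double_lie.
Proof.
have sum3 (A B C : k) : A + B + C = 0 -> C = - A - B.
  by move=> h; rewrite -(addrK (A + B) C) [C + _]addrC h; ring.
split=> [|a|a b c].
- have E1 s (a b : drinfeld_double g) om :
      ev om (s *: a + b).1 = s * ev om a.1 + ev om b.1.
    by rewrite dualD dualZ.
  have E2 s (a b : drinfeld_double g) z :
      ev (s *: a + b).2 z = s * ev a.2 z + ev b.2 z.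
    by rewrite dualDl dualZl.
  split=> c s a b; apply: double_ext => [om|z].
  + rewrite [LHS]double_lie1 [RHS]E1 !double_lie1 2!lieZDl.
    by rewrite dualD dualZ dualDl dualZl E1; ring.
  + rewrite [LHS]double_lie2 [RHS]E2 !double_lie2 2!lieZDl.
    by rewrite dualD dualZ dualDl dualZl E2; ring.
  + rewrite [LHS]double_lie1 [RHS]E1 !double_lie1 lieZDr lieZDl.
    by rewrite dualD dualZ dualDl dualZl E1; ring.
  + rewrite [LHS]double_lie2 [RHS]E2 !double_lie2 lieZDr lieZDl.
    by rewrite dualD dualZ dualDl dualZl E2; ring.
- apply: double_ext => [om|z].
  + by rewrite double_lie1 !liexx !dual0; ring.
  + by rewrite double_lie2 !liexx !dual0l; ring.
apply: double_ext => [om|z].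
- have D1 (u v : drinfeld_double g) : ev om (u + v).1 = ev om u.1 + ev om v.1.
    exact: dualD.
  rewrite 2!D1 !double_lie_lie1 !lie_jacobiA !(dualDl, dualNl) dual0.
  have := congr1 (ev om) (lie_jacobi a.1 b.1 c.1).
  by rewrite !dualD dual0 => /sum3->; ring.
- have D2 (u v : drinfeld_double g) : ev (u + v).2 z = ev u.2 z + ev v.2 z.
    exact: dualDl.
  rewrite 2!D2 !double_lie_lie2 dual0l.
  have := congr1 (fun t : ldual g => ev t z) (lie_jacobi a.2 b.2 c.2).
  by rewrite !dualDl dual0l => /sum3->; ring.
Qed.

HB.instance Definition _ :=
  Lmodule_isLieAlgebra.Build k (drinfeld_double g) double_lie_is_lie.

Lemma double_lie_g (x y : g) : lie (in_g x) (in_g y) = in_g (lie x y).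
Proof.
apply: double_ext => [om|z].
  by rewrite [LHS]double_lie1 /= !lie0l !dual0l; ring.
by rewrite [LHS]double_lie2 /= lie0l !dual0l; ring.
Qed.

Lemma double_lie_dual (xi eta : ldual g) :
  lie (in_dual xi) (in_dual eta) = in_dual (lie xi eta).
Proof.
apply: double_ext => [om|z].
  by rewrite [LHS]double_lie1 /= lie0l !dual0; ring.
by rewrite [LHS]double_lie2 /= !lie0l !dual0; ring.
Qed.

Lemma double_lie_mixed (x : g) (xi : ldual g) :
  lie (in_g x) (in_dual xi) = in_dual (coad x xi) - in_g (coad_dual xi x).
Proof.
apply: double_ext => [om|z].
  rewrite [LHS]double_lie1 /= lie0r lie0l dual0 dual0l.
  by rewrite dualD dualN dual0 coad_dualE; ring.
rewrite [LHS]double_lie2 /= lie0l dual0l.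
by rewrite dualDl coadE dualNl !dual0l; ring.
Qed.

End Double.

Section QuasiFrobenius.
Variables (k : fieldType) (q : lieAlgType k).

Definition quasi_Frobenius (beta : {biscalar q}) : Prop :=
  [/\ (forall u, (forall v, beta u v = 0) -> u = 0),
      (forall u v, beta u v = - beta v u) &
      (forall u v w,
         beta (lie u v) w + beta (lie v w) u + beta (lie w u) v = 0)].

Definition is_derivation (d : {linear q -> q}) : Prop :=
  forall u v, d (lie u v) = lie (d u) v + lie u (d v).

(* Linearity of a map h -> gl(q), stated pointwise. *)
Definition gl_linear (h : lmodType k) (rho : h -> {linear q -> q}) : Prop :=
  forall (a : k) (x y : h) (u : q), rho (a *: x + y) u = a *: rho x u + rho y u.

Definition is_representation (h : lieAlgType k) (rho : h -> {linear q -> q}) :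
  Prop :=
  gl_linear rho /\
  forall (x y : h) (u : q), rho (lie x y) u = rho x (rho y u) - rho y (rho x u).

Definition equivariant_quasi_Frobenius (h : finLieAlgType k)
    (beta : {biscalar q}) (rho : h -> {linear q -> q}) : Prop :=
  [/\ quasi_Frobenius beta,
      is_representation rho,
      (forall x, is_derivation (rho x)) &
      (forall x u v, beta (rho x u) v + beta u (rho x v) = 0)].

End QuasiFrobenius.

(* Main.v *)
Require Import Defs.
From mathcomp Require Import all_boot all_order all_algebra.

Set Implicit Arguments.
Unset Strict Implicit.
Unset Printing Implicit Defensive.
Import GRing.Theory.
Local Open Scope ring_scope.

(** Every axiom of an equivariant quasi-Frobenius Lie algebra is additive in the
    acting element (for the bracket relation: biadditive and antisymmetric), so
    over D(g) = g + g^* each can be tested on g and on g^* separately.  The only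
    mixed instance is the bracket relation for a pair (x, xi), which is (a). *)

Section GlLinear.
Variables (k : fieldType) (q h : lieAlgType k) (rho : h -> {linear q -> q}).
Hypothesis rho_linear : gl_linear rho.

(** [gl_linear] is a pointwise identity rather than a bundled linear map, so the additive laws are
    extracted from it, here with scalar 1. *)
Lemma gl_linearD x y u : rho (x + y) u = rho x u + rho y u.
Proof. by have := rho_linear 1 x y u; rewrite !scale1r. Qed.

Lemma gl_linear0 u : rho 0 u = 0.
Proof. by apply: (addrI (rho 0 u)); rewrite -gl_linearD !addr0. Qed.

Lemma gl_linearN x u : rho (- x) u = - rho x u.
Proof.
by apply: (addrI (rho x u)); rewrite -gl_linearD !subrr gl_linear0.
Qed.

(** The bracket relation is isolated at a single pair so that it can be propagated along sums in
    either argument. *)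
Definition preserves_lie (x y : h) : Prop :=
  forall u, rho (lie x y) u = rho x (rho y u) - rho y (rho x u).

(** Both sides change sign under the swap. This reduces right additivity to left additivity and
    pairs (xi, x) to pairs (x, xi). *)
Lemma preserves_lieC x y : preserves_lie x y -> preserves_lie y x.
Proof. by move=> xy u; rewrite lieC gl_linearN xy opprB. Qed.

Lemma preserves_lieDl x y z :
  preserves_lie x z -> preserves_lie y z -> preserves_lie (x + y) z.
Proof.
move=> xz yz u; rewrite lieDl !gl_linearD xz yz linearD.
by rewrite opprD addrACA.
Qed.

Lemma preserves_lieDr x y z :
  preserves_lie x y -> preserves_lie x z -> preserves_lie x (y + z).
Proof.
by move=> xy xz; apply: preserves_lieC; apply: preserves_lieDl;
  apply: preserves_lieC.
Qed.

Lemma derivationD x y :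
  is_derivation (rho x) -> is_derivation (rho y) -> is_derivation (rho (x + y)).
Proof. by move=> dx dy u v; rewrite !gl_linearD dx dy lieDl lieDr addrACA. Qed.

Lemma skew_adjointD (beta : {biscalar q}) x y :
  (forall u v, beta (rho x u) v + beta u (rho x v) = 0) ->
  (forall u v, beta (rho y u) v + beta u (rho y v) = 0) ->
  forall u v, beta (rho (x + y) u) v + beta u (rho (x + y) v) = 0.
Proof.
by move=> sx sy u v; rewrite !gl_linearD linearDl linearDr addrACA sx sy addr0.
Qed.

End GlLinear.

Section Pullback.
Variables (k : fieldType) (q : lieAlgType k) (h h' : finLieAlgType k).
Variables (beta : {biscalar q}) (rho : h -> {linear q -> q}) (f : h' -> h).
Hypothesis f_linear : linear f.
Hypothesis f_lie : forall x y, f (lie x y) = lie (f x) (f y).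

(** The derivation and skewness conditions concern one operator at a time, so they pass to
    [rho (f x)] at once; only the representation axioms use that [f] is a Lie homomorphism. Applied
    to [in_g] and [in_dual], this yields (b) and (c). *)
Lemma equivariant_quasi_Frobenius_comp :
  equivariant_quasi_Frobenius beta rho ->
  equivariant_quasi_Frobenius beta (rho \o f).
Proof.
case=> qF [rho_lin rho_lie] rho_der rho_skew; split=> //=.
by split=> [a x y u|x y u] /=; rewrite (f_linear, f_lie).
Qed.

End Pullback.

Section DoubleDecomposition.
Variables (k : fieldType) (g : lieBialgType k).

Lemma in_g_linear : linear (@in_g k g).
Proof. by move=> a x y; congr (_, _); rewrite /= scaler0 addr0. Qed.

Lemma in_dual_linear : linear (@in_dual k g).
Proof. by move=> a x y; congr (_, _); rewrite /= scaler0 addr0. Qed.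

Lemma double_decomp (a : drinfeld_double g) : a = in_g a.1 + in_dual a.2.
Proof. by case: a => x xi; congr (_, _); rewrite /= ?addr0 ?add0r. Qed.

End DoubleDecomposition.

Theorem proposition5p2 (k : fieldType) (k_char0 : [pchar k] =i pred0)
    (g : lieBialgType k) (q : lieAlgType k) (beta : {biscalar q})
    (qF : quasi_Frobenius beta)
    (rho : drinfeld_double g -> {linear q -> q}) (rho_linear : gl_linear rho) :
  let phi := fun x : g => rho (in_g x) in
  let psi := fun xi : ldual g => rho (in_dual xi) in
  equivariant_quasi_Frobenius beta rho <->
  [/\ (forall (x : g) (xi : ldual g) (u : q),
         psi (coad x xi) u - phi (coad_dual xi x) u
         = phi x (psi xi u) - psi xi (phi x u)),
      equivariant_quasi_Frobenius beta phi &
      equivariant_quasi_Frobenius beta psi].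
Proof.
move=> phi psi.
(* By the mixed bracket of the double, the left side of (a) is [rho] at
   [lie (in_g x) (in_dual xi)]. *)
have mixedE x xi u : psi (coad x xi) u - phi (coad_dual xi x) u
    = rho (lie (in_g x) (in_dual xi)) u.
  by rewrite double_lie_mixed (gl_linearD rho_linear) (gl_linearN rho_linear).
split=> [rhoF | [mixed phiF psiF]].
  split=> [x xi u||].
  - by case: rhoF => _ [_ rho_lie] _ _; rewrite mixedE rho_lie.
  - apply: (equivariant_quasi_Frobenius_comp _ _ rhoF); first exact: in_g_linear.
    by move=> x y; rewrite double_lie_g.
  - apply: (equivariant_quasi_Frobenius_comp _ _ rhoF).
      exact: in_dual_linear.
    by move=> x y; rewrite double_lie_dual.
have [_ [_ phi_lie] phi_der phi_skew] := phiF.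
have [_ [_ psi_lie] psi_der psi_skew] := psiF.
have mixed_lie x xi : preserves_lie rho (in_g x) (in_dual xi).
  by move=> u; rewrite -mixedE mixed.
split=> // [|a|a].
- split=> // a b; rewrite -/(preserves_lie rho a b).
  rewrite (double_decomp a) (double_decomp b).
  apply: (preserves_lieDl rho_linear); apply: (preserves_lieDr rho_linear).
  + by move=> u; rewrite double_lie_g phi_lie.
  + exact: mixed_lie.
  + by apply: (preserves_lieC rho_linear); apply: mixed_lie.
  + by move=> u; rewrite double_lie_dual psi_lie.
- rewrite (double_decomp a); apply: (derivationD rho_linear).
    exact: phi_der.
  exact: psi_der.
- rewrite (double_decomp a); apply: (skew_adjointD rho_linear).
    exact: phi_skew.
  exact: psi_skew.
Qed.
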